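(* Let $N\geq 1$ and $K\geq 0$ be natural numbers. (1) $N$-nomials add up to $N^{K}$: $$\sum_{0\leq i\leq (N-1)\cdot K} C_{N}(K,i) \;=\; N^{K}.$$ (2) $N$-nomials satisfy a Vandermonde property: for each $0\leq i\leq (N-1)\cdot K$, if $K=K_{1}+K_{2}$ with $K_1,K_2\in\mathbb{N}$, then $$C_{N}(K,i) \;=\; \sum_{\substack{0\leq i_{1}\leq (N-1)\cdot K_{1},\ 0\leq i_{2}\leq (N-1)\cdot K_{2},\\ i_{1}+i_{2}=i}} C_{N}(K_{1},i_{1})\cdot C_{N}(K_{2},i_{2}).$$
   Context: For $N\geq 1$ write $\boldsymbol{N}=\{0,1,\ldots,N-1\}\subseteq\mathbb{N}$. For $K\in\mathbb{N}$ and $0\leq i\leq (N-1)\cdot K$, the $N$-nomial coefficient is the natural number $$C_{N}(K,i) := \big|\{(n_1,\ldots,n_K)\in\boldsymbol{N}^{K} \mid n_1+\cdots+n_K = i\}\big|.$$ *)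

(* Defs.v *)
From mathcomp Require Import all_boot.

Set Implicit Arguments.
Unset Strict Implicit.
Unset Printing Implicit Defensive.

(* The N-nomial coefficient C_N(K, i), with {0, ..., N-1}^K rendered as
   K.-tuple 'I_N.  It is total in N and i; it counts no tuple, hence is 0,
   when N > 0 and i > (N - 1) * K. *)
Definition nnomial (N K i : nat) : nat :=
  #|[set t : K.-tuple 'I_N | \sum_(k < K) (tnth t k : nat) == i]|.

(* Main.v *)
(* Both parts weigh the tuples t in {0, ..., N-1}^K by their entry sum w(t), via
   sum_i C_N(K, i) F(i) = sum_t F(w(t)): take F = 1 for (1); for (2), use it for
   K1 and K2 and split a (K1 + K2)-tuple as a concatenation. *)
Require Import Defs.
From mathcomp Require Import all_boot.

Definition tuple_weight {N K : nat} (t : K.-tuple 'I_N) : nat :=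
  \sum_(k < K) (tnth t k : nat).

Lemma nnomialE (N K i : nat) :
  nnomial N K i = \sum_(t : K.-tuple 'I_N) (tuple_weight t == i).
Proof. by rewrite /nnomial -sum1dep_card big_mkcond. Qed.

Lemma tuple_weight_le (N K : nat) (t : K.-tuple 'I_N) :
  tuple_weight t <= (N - 1) * K.
Proof.
rewrite mulnC -[X in X * _](card_ord K) -sum_nat_const.
by apply: leq_sum => k _; rewrite subn1; case: (tnth t k) => x; case: N {t}.
Qed.

Lemma tuple_weight_cat (N K1 K2 : nat)
    (t1 : K1.-tuple 'I_N) (t2 : K2.-tuple 'I_N) :
  tuple_weight [tuple of t1 ++ t2] = tuple_weight t1 + tuple_weight t2.
Proof.
(* Sums over indices become sums over the underlying sequences, where [big_cat] applies. *)
by rewrite /tuple_weight -!(big_tuple _ _ _ predT (fun x : 'I_N => nat_of_ord x)) big_cat.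
Qed.

(** After exchanging the sums, each tuple contributes [F] only at its own weight, which
    [tuple_weight_le] places within the range. *)
Lemma sum_nnomial (N K : nat) (F : nat -> nat) :
  \sum_(0 <= i < ((N - 1) * K).+1) nnomial N K i * F i
    = \sum_(t : K.-tuple 'I_N) F (tuple_weight t).
Proof.
under eq_bigr do rewrite nnomialE big_distrl /=.
rewrite exchange_big /=; apply: eq_bigr => t _.
under eq_bigr do rewrite mulnbl eq_sym.
by rewrite -big_mkcond big_nat1_eq ltnS tuple_weight_le.
Qed.

(** The fixed length [K1] of the first block makes the splitting unique; injectivity and equal
    cardinalities then suffice. *)
Lemma cat_tuple_bij (T : finType) (K1 K2 : nat) :
  bijective (fun p : K1.-tuple T * K2.-tuple T => [tuple of p.1 ++ p.2]).
Proof.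
apply: inj_card_bij => [[s1 s2] [t1 t2] /(congr1 val)/eqP /=|].
  rewrite eqseq_cat ?size_tuple // => /andP[/eqP e1 /eqP e2].
  by congr pair; apply: val_inj.
by rewrite card_prod !card_tuple expnD.
Qed.

Theorem lemma2 (N K : nat) (hN : 1 <= N) :
  (\sum_(0 <= i < ((N - 1) * K).+1) nnomial N K i = N ^ K)
  /\
  (forall i K1 K2 : nat,
     i <= (N - 1) * K ->
     K = K1 + K2 ->
     nnomial N K i =
       \sum_(0 <= i1 < ((N - 1) * K1).+1)
         \sum_(0 <= i2 < ((N - 1) * K2).+1 | i1 + i2 == i)
           nnomial N K1 i1 * nnomial N K2 i2).
Proof.
split=> [|i K1 K2 _ ->].
  under eq_bigr do rewrite -[nnomial _ _ _]muln1.
  by rewrite (sum_nnomial N K (fun=> 1)) sum1_card card_tuple card_ord.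
(* The constraint [i1 + i2 == i] becomes a 0/1 factor, so that the whole inner sum is a function of
   [i1] and can serve as [F]. *)
transitivity (\sum_(0 <= i1 < ((N - 1) * K1).+1) nnomial N K1 i1 *
    \sum_(0 <= i2 < ((N - 1) * K2).+1) nnomial N K2 i2 * (i1 + i2 == i)).
  rewrite (sum_nnomial N K1 (fun i1 =>
    \sum_(0 <= i2 < _) nnomial N K2 i2 * (i1 + i2 == i))).
  under [RHS]eq_bigr => t1 _ do
    rewrite (sum_nnomial N K2 (fun i2 => tuple_weight t1 + i2 == i : nat)).
  (* Both sides now count pairs [(t1, t2)] whose weights add up to [i]. *)
  rewrite nnomialE pair_big (reindex _ (onW_bij _ (cat_tuple_bij _ K1 K2))) /=.
  by apply: eq_bigr => p _; rewrite tuple_weight_cat.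
apply: eq_bigr => i1 _; rewrite big_distrr [RHS]big_mkcond.
by apply: eq_bigr => i2 _ /=; case: eqP => _; rewrite ?muln1 ?muln0.
Qed.
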